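(* Let $A$ be a finite set and $cl:2^A\to 2^A$ a closure, and suppose that the set $\mathrm{Im}(cl)$ is given as part of the input. Then the problem MGS (Minimum Generator Set) for $cl$ can be solved in $O(c_{cl}|A|\,|\mathrm{Im}(cl)|)$ time.
   Context: A function $cl: 2^A\to 2^A$ is a closure if for all $X,Y\subseteq A$: $X\subseteq cl(X)$; $X\subseteq Y$ implies $cl(X)\subseteq cl(Y)$; and $cl(cl(X))=cl(X)$. $\mathrm{Im}(cl)=\{Y\subseteq A\mid \exists X\subseteq A,\ Y=cl(X)\}$ is the set of closed sets. MGS is the following problem: given a set $A$, a polytime computable closure $cl:2^A\to 2^A$ and an integer $k$, is there a set $X\subseteq A$ with $|X|\le k$ such that $cl(X)=A$? The quantity $c_{cl}$ is such that, for any $X'=X\cup\{w\}\subseteq A$ and given $cl(X)$, determining $cl(X')$ can be done in time $c_{cl}$. In the time count, elementary bookkeeping (storing for each closed set a generator of it as a label, looking up a label, adding one element to a label, comparing recorded sizes) is counted as constant time. *)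

(* Defs.v *)
From HB Require Import structures.
From mathcomp Require Import all_boot all_order all_algebra.

Set Implicit Arguments.
Unset Strict Implicit.
Unset Printing Implicit Defensive.

Definition closure_op (A : finType) (cl : {set A} -> {set A}) : Prop :=
  [/\ forall X : {set A}, X \subset cl X,
      forall X Y : {set A}, X \subset Y -> cl X \subset cl Y
    & forall X : {set A}, cl (cl X) = cl X].

Definition closed_sets (A : finType) (cl : {set A} -> {set A}) :
  {set {set A}} := [set cl X | X : {set A}].

Definition mgs (A : finType) (cl : {set A} -> {set A}) (k : int) : bool :=
  [exists X : {set A}, (#|X|%:Z <= k)%R && (cl X == [set: A])].

(* The model of computation is a unit-cost random access machine, presented as
   a structured language over integer registers and integer arrays, with
   addition, subtraction and comparison as the only arithmetic, and with one
   external procedure [query].  Evaluating an expression costs one unit per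
   node. *)
Inductive expr : Type :=
| Const of int
| Reg of nat
| Arr of nat & expr
| Add of expr & expr
| Sub of expr & expr.

(* The guards of [If] and [While] are comparisons [e1 <= e2]. *)
Inductive cmd : Type :=
| Skip
| Set_reg of nat & expr
| Set_arr of nat & expr & expr
| Query of nat & expr & expr
| Seq of cmd & cmd
| If of expr & expr & cmd & cmd
| While of expr & expr & cmd.

Record state : Type := State {
  reg : nat -> int;
  arr : nat -> int -> int
}.

Definition upd (I : eqType) (T : Type) (f : I -> T) (i : I) (v : T) : I -> T :=
  fun j => if j == i then v else f j.

Definition set_reg (st : state) (x : nat) (v : int) : state :=
  State (upd (reg st) x v) (arr st).

Definition set_arr (st : state) (a : nat) (i v : int) : state :=
  State (reg st) (upd (arr st) a (upd (arr st a) i v)).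

Fixpoint eval (st : state) (e : expr) : int :=
  match e with
  | Const z => z
  | Reg x => reg st x
  | Arr a e1 => arr st a (eval st e1)
  | Add e1 e2 => (eval st e1 + eval st e2)%R
  | Sub e1 e2 => (eval st e1 - eval st e2)%R
  end.

Fixpoint ecost (e : expr) : nat :=
  match e with
  | Const _ | Reg _ => 1
  | Arr _ e1 => (ecost e1).+1
  | Add e1 e2 | Sub e1 e2 => (ecost e1 + ecost e2).+1
  end.

(* [exec query c p st t st']: started in [st], the program [p] terminates in
   [st'] after time exactly [t], where each call to [query] is charged [c]. *)
Inductive exec (query : int -> int -> int) (c : nat) :
  cmd -> state -> nat -> state -> Prop :=
| ExecSkip st :
    exec query c Skip st 1 st
| ExecSetReg x e st :
    exec query c (Set_reg x e) st (ecost e).+1 (set_reg st x (eval st e))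
| ExecSetArr a e1 e2 st :
    exec query c (Set_arr a e1 e2) st (ecost e1 + ecost e2).+1
      (set_arr st a (eval st e1) (eval st e2))
| ExecQuery x e1 e2 st :
    exec query c (Query x e1 e2) st (c + (ecost e1 + ecost e2).+1)
      (set_reg st x (query (eval st e1) (eval st e2)))
| ExecSeq p1 p2 st t1 st1 t2 st2 :
    exec query c p1 st t1 st1 -> exec query c p2 st1 t2 st2 ->
    exec query c (Seq p1 p2) st (t1 + t2) st2
| ExecIfTrue e1 e2 p1 p2 st t st' :
    (eval st e1 <= eval st e2)%R -> exec query c p1 st t st' ->
    exec query c (If e1 e2 p1 p2) st ((ecost e1 + ecost e2).+1 + t) st'
| ExecIfFalse e1 e2 p1 p2 st t st' :
    ~~ (eval st e1 <= eval st e2)%R -> exec query c p2 st t st' ->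
    exec query c (If e1 e2 p1 p2) st ((ecost e1 + ecost e2).+1 + t) st'
| ExecWhileTrue e1 e2 p st t1 st1 t2 st2 :
    (eval st e1 <= eval st e2)%R -> exec query c p st t1 st1 ->
    exec query c (While e1 e2 p) st1 t2 st2 ->
    exec query c (While e1 e2 p) st ((ecost e1 + ecost e2).+1 + t1 + t2) st2
| ExecWhileFalse e1 e2 p st :
    ~~ (eval st e1 <= eval st e2)%R ->
    exec query c (While e1 e2 p) st (ecost e1 + ecost e2).+1 st.

Lemma exec_det query c p st t1 st1 t2 st2 :
  exec query c p st t1 st1 -> exec query c p st t2 st2 ->
  t1 = t2 /\ st1 = st2.
Proof.
move=> H; elim: H t2 st2 => {p st t1 st1} *;
  match goal with H : exec _ _ _ _ ?t ?s |- _ = ?t /\ _ = ?s =>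
    inversion H; subst end => //;
  try (by match goal with
    H1 : is_true ?b, H2 : is_true (~~ ?b) |- _ => rewrite H1 in H2 end);
  repeat match goal with
    IH : forall t s, exec _ _ ?p ?a t s -> _, H : exec _ _ ?p ?a _ _ |- _ =>
      case: (IH _ _ H) => ? ?; subst; clear IH end => //.
Qed.

(* In an instance, the elements of A and the closed sets are listed, without
   repetition, by [es] and [cs], and are referred to by their positions there.
   [query] determines cl(X u {w}) from cl(X) and w; that it returns a position
   in [cs] is the convention that the record kept for a closed set is found in
   constant time.  It is unconstrained on other arguments. *)
Definition determines (A : finType) (cl : {set A} -> {set A})
    (es : seq A) (cs : seq {set A}) (query : int -> int -> int) : Prop :=
  forall (X : {set A}) (w : A),
    (query (index (cl X) cs)%:Z (index w es)%:Z = (index (cl (w |: X)) cs)%:Z)%R.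

(* Registers 0, 1, 2 contain |A|, |Im(cl)| and k; array 0 contains the
   incidence matrix of Im(cl), row by row: its entry i * |A| + j tells whether
   the j-th element belongs to the i-th closed set.  Everything else is 0. *)
Definition incidence (A : finType) (es : seq A) (cs : seq {set A}) : seq int :=
  [seq ((w \in Y : nat)%:Z)%R | Y : {set A} <- cs, w : A <- es].

Definition mgs_input (A : finType) (es : seq A) (cs : seq {set A}) (k : int) :
  state :=
  State
    (fun x => nth 0 [:: (size es)%:Z; (size cs)%:Z; k] x)%R
    (fun a i => if (a == 0) && (0 <= i)%R then
                  nth 0%R (incidence es cs) `|i|%N
                else 0%R).

(* Main.v *)
(* The closed sets form a graph with an edge from Y to cl(Y u {w}) for each
   element w, and X generates A exactly when the path spelled by the elements of
   X leads from cl(set0) to A.  So the least size of a generating set is the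
   distance from cl(set0) to A, and breadth-first search finds it with one query
   per edge, of which there are |A| |Im(cl)|.  One pass over the incidence
   matrix locates the two end points: cl(set0) is the smallest closed set and A
   the largest. *)
Require Import Defs.
From mathcomp Require Import all_boot all_order all_algebra.
From mathcomp Require Import zify.

Set Implicit Arguments.
Unset Strict Implicit.
Unset Printing Implicit Defensive.

(** * Total-correctness rules with running time *)

Definition run (query : int -> int -> int) (c : nat) (p : cmd) (st : state)
    (Q : nat -> state -> Prop) : Prop :=
  exists t st', exec query c p st t st' /\ Q t st'.

Lemma run_mono query c p st (Q Q' : nat -> state -> Prop) :
  run query c p st Q -> (forall t st', Q t st' -> Q' t st') ->
  run query c p st Q'.
Proof. by move=> [t [st' [E H]]] QQ'; exists t, st'; split; last exact: QQ'. Qed.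

Lemma run_skip query c st (Q : nat -> state -> Prop) :
  Q 1 st -> run query c Skip st Q.
Proof. by move=> H; exists 1, st; split=> //; constructor. Qed.

Lemma run_set_reg query c x e st (Q : nat -> state -> Prop) :
  Q (ecost e).+1 (set_reg st x (eval st e)) ->
  run query c (Set_reg x e) st Q.
Proof. by move=> H; do 2 eexists; split; first exact: ExecSetReg. Qed.

Lemma run_set_arr query c a e1 e2 st (Q : nat -> state -> Prop) :
  Q (ecost e1 + ecost e2).+1 (set_arr st a (eval st e1) (eval st e2)) ->
  run query c (Set_arr a e1 e2) st Q.
Proof. by move=> H; do 2 eexists; split; first exact: ExecSetArr. Qed.

Lemma run_query query c x e1 e2 st (Q : nat -> state -> Prop) :
  Q (c + (ecost e1 + ecost e2).+1)
    (set_reg st x (query (eval st e1) (eval st e2))) ->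
  run query c (Query x e1 e2) st Q.
Proof. by move=> H; do 2 eexists; split; first exact: ExecQuery. Qed.

(** Nesting the second run in the postcondition of the first lets a program be executed symbolically
    from its first command on, while the time accumulates inside [Q]. *)
Lemma run_seq query c p1 p2 st (Q : nat -> state -> Prop) :
  run query c p1 st
    (fun t1 st1 => run query c p2 st1 (fun t2 st2 => Q (t1 + t2) st2)) ->
  run query c (Seq p1 p2) st Q.
Proof.
move=> [t1 [st1 [E1 [t2 [st2 [E2 H]]]]]].
by do 2 eexists; split; first exact: ExecSeq E1 E2.
Qed.

Lemma run_if query c e1 e2 p1 p2 st (Q : nat -> state -> Prop) :
  ((eval st e1 <= eval st e2)%R ->
   run query c p1 st (fun t => Q ((ecost e1 + ecost e2).+1 + t))) ->
  (~~ (eval st e1 <= eval st e2)%R ->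
   run query c p2 st (fun t => Q ((ecost e1 + ecost e2).+1 + t))) ->
  run query c (If e1 e2 p1 p2) st Q.
Proof.
move=> H1 H2; case: (boolP (eval st e1 <= eval st e2)%R) => g.
  case: (H1 g) => t [st' [E H]].
  by do 2 eexists; split; first exact: ExecIfTrue E.
case: (H2 g) => t [st' [E H]].
by do 2 eexists; split; first exact: ExecIfFalse E.
Qed.

(* [I b st] is a loop invariant in which [b] is the time budget left for the
   remaining iterations; it pays for each pass, and an exit costs one guard. *)
Lemma run_while query c e1 e2 p (I : nat -> state -> Prop) b st :
  (forall b st, I b st -> (eval st e1 <= eval st e2)%R ->
     run query c p st
       (fun t st' => exists2 b', I b' st'
                                & (ecost e1 + ecost e2).+1 + t + b' <= b)) ->
  I b st ->
  run query c (While e1 e2 p) st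
    (fun t st' => [/\ exists b', I b' st', ~~ (eval st' e1 <= eval st' e2)%R
                    & t <= b + (ecost e1 + ecost e2).+1]).
Proof.
(* A guard costs at least 1, so every pass strictly decreases the budget; induction on it also gives
   termination. *)
move=> Ip; have [N] := ubnP b; elim: N b st => // N IH b st ltbN Ib.
case: (boolP (eval st e1 <= eval st e2)%R) => g; last first.
  do 2 eexists; split; first exact: ExecWhileFalse.
  by split=> //; [exists b | rewrite leq_addl].
have [t [st1 [E1 [b1 I1 le_b]]]] := Ip _ _ Ib g.
have [|t2 [st2 [E2 [I2 g2 le_t2]]]] := IH b1 st1 _ I1; first lia.
do 2 eexists; split; first exact: ExecWhileTrue E1 E2.
by split=> //; lia.
Qed.

(** * Breadth-first search on an abstract graph with labelled edges *)

(* [d v] is 1 plus the distance found from [s] to [v], and 0 if [v] has not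
   been reached; the labels of the nodes queued before position [h] have all
   been explored, and so have the first [j] labels of the node at [h]. *)
Record bfs_inv (n m s : nat) (f : nat -> nat -> nat) (d : nat -> nat)
    (Q : seq nat) (h j : nat) : Prop := BfsInv {
  bfs_uniq : uniq Q;
  bfs_bound : forall v, v \in Q -> v < n;
  bfs_reached : forall v, (0 < d v) = (v \in Q);
  bfs_source : d s = 1;
  bfs_head : h <= size Q;
  bfs_sorted : forall a b, a <= b -> b < size Q -> d (nth 0 Q a) <= d (nth 0 Q b);
  bfs_gap : h < size Q -> forall v, d v <= (d (nth 0 Q h)).+1;
  bfs_done : forall a w, w < m -> a < h \/ (a = h /\ w < j) -> a < size Q ->
    0 < d (f (nth 0 Q a) w) <= (d (nth 0 Q a)).+1;
  bfs_path : forall v, 0 < d v ->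
    exists ws, [/\ all (ltn^~ m) ws, (size ws).+1 = d v & foldl f s ws = v] }.

Lemma bfs_inv_init n m s f :
  s < n -> bfs_inv n m s f (upd (fun=> 0) s 1) [:: s] 0 0.
Proof.
move=> ltsn; rewrite /upd; split=> //=.
- by move=> v; rewrite inE => /eqP->.
- by move=> v; rewrite inE; case: eqP.
- by rewrite eqxx.
- by case=> [|a] [|b] //=; rewrite eqxx.
- by move=> _ v; rewrite eqxx; case: eqP.
- by move=> a w _ [|[]].
- by move=> v; case: eqP => // -> _; exists [::].
Qed.

Lemma bfs_inv_size n m s f d Q h j : bfs_inv n m s f d Q h j -> size Q <= n.
Proof.
move=> B; rewrite -[n](size_iota 0); apply: uniq_leq_size.
  exact: bfs_uniq B.
by move=> v /(bfs_bound B); rewrite mem_iota.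
Qed.

(** The queue is sorted by distance, so the gap bound at the old head carries over to the next
    one. *)
Lemma bfs_inv_next n m s f d Q h j :
  bfs_inv n m s f d Q h j -> h < size Q -> m <= j ->
  bfs_inv n m s f d Q h.+1 0.
Proof.
move=> B lth lemj; have Bd := bfs_done B; have Bg := bfs_gap B lth.
have Bs := bfs_sorted B.
case: B; split=> //.
- by move=> lth1 v; apply: leq_trans (Bg v) _; rewrite ltnS; apply: Bs.
- by move=> a w ltwm [ltah|[_ //]] lta; apply: Bd => //; lia.
Qed.

(** By [bfs_gap], a node reached earlier is already at most one step farther than the head, so the
    edge [j] needs no update. *)
Lemma bfs_inv_seen n m s f d Q h j :
  bfs_inv n m s f d Q h j -> h < size Q -> 0 < d (f (nth 0 Q h) j) ->
  bfs_inv n m s f d Q h j.+1.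
Proof.
move=> B lth dr; have Bd := bfs_done B; have Bg := bfs_gap B lth.
case: B; split=> // a w ltwm H lta.
have [|[ea lew]] : (a < h \/ a = h /\ w < j) \/ a = h /\ w = j by lia.
  by move=> ?; apply: Bd.
by rewrite ea lew dr Bg.
Qed.

(** By [bfs_gap], the value given to [r] is the largest one present, so appending [r] keeps the
    queue sorted; a path to [r] is one to the head followed by the label [j]. *)
Lemma bfs_inv_new n m s f d Q h j :
  bfs_inv n m s f d Q h j -> h < size Q -> j < m ->
  let r := f (nth 0 Q h) j in
  r < n -> d r = 0 ->
  bfs_inv n m s f (upd d r (d (nth 0 Q h)).+1) (rcons Q r) h j.+1.
Proof.
move=> B lth ltjm r ltrn dr0; set x := nth 0 Q h.
have rQ : r \notin Q by rewrite -(bfs_reached B) dr0.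
have nthQ a : a < size Q -> nth 0 (rcons Q r) a = nth 0 Q a.
  by move=> lta; rewrite nth_rcons lta.
have dQ a : a < size Q -> upd d r (d x).+1 (nth 0 Q a) = d (nth 0 Q a).
  move=> lta; rewrite /upd; case: eqP => // E.
  by move: rQ; rewrite -E mem_nth.
have dold v : 0 < d v -> upd d r (d x).+1 v = d v.
  by rewrite /upd; case: eqP => // ->; rewrite dr0.
have dr : upd d r (d x).+1 r = (d x).+1 by rewrite /upd eqxx.
have Bg := bfs_gap B lth.
have xpos : 0 < d x by rewrite (bfs_reached B) mem_nth.
split.
- by rewrite rcons_uniq rQ (bfs_uniq B).
- by move=> v; rewrite mem_rcons inE => /orP[/eqP->//|/(bfs_bound B)].
- move=> v; rewrite mem_rcons inE /upd; case: eqP => //= _.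
  exact: (bfs_reached B).
- by rewrite dold (bfs_source B).
- by rewrite size_rcons; lia.
- move=> a b leab; rewrite size_rcons ltnS leq_eqVlt => /orP[/eqP eb|ltb].
    rewrite [in X in _ <= X]nth_rcons eb ltnn eqxx dr.
    move: leab; rewrite eb leq_eqVlt => /orP[/eqP ea|lta].
      by rewrite nth_rcons ea ltnn eqxx dr.
    by rewrite nthQ // dQ.
  have lta : a < size Q by lia.
  by rewrite !nthQ // !dQ //; apply: (bfs_sorted B).
- move=> _ v; rewrite nthQ // dQ // /upd; case: eqP => // _; exact: Bg.
- move=> a w ltwm H; rewrite size_rcons ltnS => lea.
  have lta : a < size Q by lia.
  rewrite nthQ // dQ //.
  have [Hold|[-> ->]] : (a < h \/ a = h /\ w < j) \/ a = h /\ w = j by lia.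
    have := bfs_done B ltwm Hold lta; case/andP=> p1 p2.
    by rewrite dold // p1.
  by rewrite -/r dr /=.
- move=> v; rewrite /upd; case: eqP => [-> _|_].
    have [ws [aw sw fw]] := bfs_path B xpos.
    exists (rcons ws j); rewrite all_rcons size_rcons foldl_rcons sw fw.
    by split=> //=; rewrite ltjm.
  exact: (bfs_path B).
Qed.

(** With the queue exhausted, every edge out of a reached node has been explored, so each label of a
    word raises [d] by at most 1. Together with [bfs_path] this makes [d] exactly 1 plus the
    distance. *)
Lemma bfs_inv_final n m s f d Q j ws :
  bfs_inv n m s f d Q (size Q) j -> all (ltn^~ m) ws ->
  0 < d (foldl f s ws) <= (size ws).+1.
Proof.
move=> B; elim/last_ind: ws => [|ws w IH] /=; first by rewrite (bfs_source B).
rewrite all_rcons foldl_rcons size_rcons => /andP[ltw /IH/andP[p1 p2]].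
move: (p1); rewrite (bfs_reached B) => /(nthP 0)[a lta E].
have := bfs_done B ltw (or_introl lta) lta; rewrite E => /andP[-> p3] /=; lia.
Qed.

(** * The program *)

Local Notation numA := 0 (only parsing).
Local Notation numC := 1 (only parsing).
Local Notation bound := 2 (only parsing).
Local Notation row := 3 (only parsing).
Local Notation col := 4 (only parsing).
Local Notation pos := 5 (only parsing).
Local Notation cnt := 6 (only parsing).
Local Notation best := 7 (only parsing).
Local Notation src := 8 (only parsing).
Local Notation tgt := 9 (only parsing).
Local Notation head := 10 (only parsing).
Local Notation tail := 11 (only parsing).
Local Notation lab := 12 (only parsing).
Local Notation node := 13 (only parsing).
Local Notation dist := 1 (only parsing).
Local Notation queue := 2 (only parsing).

Local Notation "p ;; q" := (Seq p q) (at level 85, right associativity).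
Local Notation succ e := (Add e (Const 1%R)).

(* [pos] follows row * |A| + col, as the machine has no multiplication. *)
Definition scan_body : cmd :=
  If (succ (Reg col)) (Reg numA)
    (Set_reg cnt (Add (Reg cnt) (Arr 0 (Reg pos))) ;;
     Set_reg pos (succ (Reg pos)) ;;
     Set_reg col (succ (Reg col)))
    (If (Reg cnt) (Reg best)
       (Set_reg best (Reg cnt) ;; Set_reg src (Reg row)) Skip ;;
     If (Reg numA) (Reg cnt) (Set_reg tgt (Reg row)) Skip ;;
     Set_reg cnt (Const 0%R) ;;
     Set_reg col (Const 0%R) ;;
     Set_reg row (succ (Reg row))).

Definition scan_prog : cmd :=
  Set_reg best (Reg numA) ;; While (succ (Reg row)) (Reg numC) scan_body.

(** Distances are stored shifted by 1, so that the initial 0 of the array [dist] means unreached. *)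
Definition bfs_body : cmd :=
  If (succ (Reg lab)) (Reg numA)
    (Query node (Arr queue (Reg head)) (Reg lab) ;;
     If (Arr dist (Reg node)) (Const 0%R)
       (Set_arr dist (Reg node) (succ (Arr dist (Arr queue (Reg head)))) ;;
        Set_arr queue (Reg tail) (Reg node) ;;
        Set_reg tail (succ (Reg tail)))
       Skip ;;
     Set_reg lab (succ (Reg lab)))
    (Set_reg lab (Const 0%R) ;; Set_reg head (succ (Reg head))).

Definition bfs_prog : cmd :=
  Set_arr dist (Reg src) (Const 1%R) ;;
  Set_arr queue (Const 0%R) (Reg src) ;;
  Set_reg head (Const 0%R) ;;
  Set_reg tail (Const 1%R) ;;
  Set_reg lab (Const 0%R) ;;
  While (succ (Reg head)) (Reg tail) bfs_body.

Definition mgs_prog : cmd :=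
  scan_prog ;;
  bfs_prog ;;
  If (Arr dist (Reg tgt)) (succ (Reg bound))
    (Set_reg 0 (Const 1%R)) (Set_reg 0 (Const 0%R)).

(** * Locating the least and the largest closed set *)

Lemma nth_incidence (A : finType) (es : seq A) (cs : seq {set A}) w0 i j :
  i < size cs -> j < size es ->
  nth 0%R (incidence es cs) (i * size es + j) =
  (nth w0 es j \in nth set0 cs i : nat)%:Z%R.
Proof.
elim: cs i => // Y cs IH [|i] /= lti ltj; rewrite nth_cat size_map.
  by rewrite mul0n add0n ltj (nth_map w0).
by rewrite -IH // mulSn -addnA ltnNge leq_addr /= addKn.
Qed.

Lemma count_take_incidence (A : finType) (es : seq A) cs k i j :
  i < size cs -> j < size es ->
  Posz (count (mem (nth set0 cs i)) (take j.+1 es)) =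
  (Posz (count (mem (nth set0 cs i)) (take j es)) +
   arr (mgs_input es cs k) 0 (Posz (i * size es + j)))%R.
Proof.
move=> lti ltj; have w0 : A by case: (es) ltj.
by rewrite (take_nth w0) // -cats1 count_cat /= (nth_incidence w0) // addn0.
Qed.

(* [Y0] stands for the least closed set cl(set0). *)
Record scan_inv (A : finType) (es : seq A) (cs : seq {set A}) (k : int)
    (Y0 : {set A}) (i j : nat) (st : state) : Prop := ScanInv {
  scan_arr : arr st = arr (mgs_input es cs k);
  scan_numA : reg st numA = Posz (size es);
  scan_numC : reg st numC = Posz (size cs);
  scan_bound : reg st bound = k;
  scan_row : reg st row = Posz i;
  scan_col : reg st col = Posz j;
  scan_pos : reg st pos = Posz (i * size es + j);
  scan_cnt : reg st cnt = Posz (count (mem (nth set0 cs i)) (take j es));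
  scan_le_row : i <= size cs;
  scan_le_col : j <= size es;
  scan_best : exists b, [/\ reg st best = Posz b, i <= index Y0 cs -> #|Y0| <= b,
      index Y0 cs < i -> b = #|Y0|
    & index Y0 cs < i -> reg st src = Posz (index Y0 cs)];
  scan_tgt : index [set: A] cs < i -> reg st tgt = Posz (index [set: A] cs) }.

(** Cardinality alone identifies the two rows: every closed set other than [Y0] is strictly larger
    than [Y0], and only A has |A| elements. *)
Lemma run_scan (A : finType) (es : seq A) (cs : seq {set A}) (k : int)
    (Y0 : {set A}) query c :
  perm_eq es (enum A) -> uniq cs -> Y0 \in cs -> [set: A] \in cs ->
  (forall Y, Y \in cs -> Y0 \subset Y) ->
  run query c scan_prog (mgs_input es cs k) (fun t st =>
    (exists j, scan_inv es cs k Y0 (size cs) j st) /\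
    t <= size cs * (size es * 30 + 40) + 7).
Proof.
move=> pe uc Y0c YTc Y0min.
have card (Y : {set A}) : count (mem Y) es = #|Y|.
  by rewrite (permP pe) cardE enumT -size_filter.
have sizeA : size es = #|A| by rewrite (perm_size pe) cardE.
apply/run_seq/run_set_reg => /=.
(* Each remaining row is allotted 30 per entry and 40 for its end; the [j] entries already read have
   been paid for. *)
pose I b st := exists i j, scan_inv es cs k Y0 i j st /\
  b + j * 30 = (size cs - i) * (size es * 30 + 40).
apply: run_mono.
  apply: (run_while (I := I) (b := size cs * (size es * 30 + 40))).
- move=> b st [i [j [S eb]]] /=.
  rewrite (scan_row S) (scan_numC S) => lti.
  have {}lti : i < size cs by lia.
  have nextrow : size cs - i = (size cs - i.+1).+1 by lia.
  rewrite nextrow mulSn in eb.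
  apply: run_if => /=; rewrite (scan_col S) (scan_numA S) => ltj.
    have {}ltj : j < size es by lia.
    have leb : 30 <= b by move: eb; set W := _ * (_ + 40); lia.
    do 2!(apply/run_seq/run_set_reg => /=); apply/run_set_reg => /=.
    exists (b - 30); last by lia.
    exists i, j.+1; split; last by rewrite nextrow mulSn; lia.
    case: S => Sa S0 S1 S2 S3 S4 S5 S6 Sr Sc Sb St; split; rewrite /= /upd //=.
    + by rewrite S4; lia.
    + by rewrite S5; lia.
    + by rewrite Sa S5 S6 (count_take_incidence k).
  have {ltj} ej : j = size es by move: (scan_le_col S); lia.
  subst j; have ecnt := scan_cnt S; rewrite take_size card in ecnt.
  set Y := nth set0 cs i in ecnt.
  have Yc : Y \in cs by rewrite mem_nth.
  (* [cs] has no repetition, so comparing positions amounts to comparing sets. *)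
  have iE Z : Z \in cs -> (i == index Z cs) = (Y == Z).
    move=> Zc; apply/eqP/eqP => [e|<-]; first by rewrite /Y e nth_index.
    by rewrite /Y index_uniq.
  have Y0E : i = index Y0 cs -> #|Y| = #|Y0|.
    by move/eqP; rewrite iE // => /eqP->.
  have Y0N : i <> index Y0 cs -> #|Y0| < #|Y|.
    move/eqP; rewrite iE // => neq; apply: proper_card.
    by rewrite properEneq eq_sym neq Y0min.
  have YTE : i = index [set: A] cs -> #|Y| = size es.
    by move/eqP; rewrite iE // sizeA => /eqP->; rewrite cardsT.
  have YTN : size es <= #|Y| -> i = index [set: A] cs.
    by rewrite sizeA -cardsT => le; apply/eqP; rewrite iE // eqEcard subsetT.
  case: S => Sa S0 S1 S2 S3 S4 S5 S6 Sr Sc [b0 [Sb B1 B2 B3]] St.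
  have le_row : i.+1 <= size cs by [].
  (* The two tests give four cases, all ending at the start of row [i.+1]; the new minimum is [#|Y|]
     or the old [b0]. *)
  apply: run_seq; apply: run_if => /=; rewrite ecnt Sb => le1;
    [apply/run_seq/run_set_reg/run_set_reg | apply: run_skip];
  (apply: run_seq; apply: run_if; rewrite /= /upd /= ?ecnt ?S0 => le2;
    [apply: run_set_reg | apply: run_skip];
   apply/run_seq/run_set_reg/run_seq/run_set_reg/run_set_reg;
   (exists ((size cs - i.+1) * (size es * 30 + 40)); last by move=> /=; lia);
   exists i.+1, 0; (split; last lia);
   split; rewrite /= /upd /= ?take0 ?mul0n; try done; try lia);
  by first [exists #|Y|; split; lia | exists b0; split; lia].
- exists 0, 0; split; last lia.
  split; rewrite /= ?take0 //.
  by exists #|A|; split=> //=; rewrite ?sizeA ?max_card.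
- move=> t st [[b [i [j [S _]]]]] /= g le_t; split; last lia.
  have ei : i = size cs.
    by move: g (scan_le_row S); rewrite (scan_row S) (scan_numC S); lia.
  by subst i; exists j.
Qed.

(** * The search program implements the abstract search *)

Record bfs_state (m : nat) (k : int) (target : nat) (d : nat -> nat)
    (Q : seq nat) (h j : nat) (st : state) : Prop := BfsState {
  bfs_numA : reg st numA = Posz m;
  bfs_limit : reg st bound = k;
  bfs_tgt : reg st tgt = Posz target;
  bfs_headr : reg st head = Posz h;
  bfs_tail : reg st tail = Posz (size Q);
  bfs_lab : reg st lab = Posz j;
  bfs_dist : forall v : nat, arr st dist (Posz v) = Posz (d v);
  bfs_queue : forall a, a < size Q -> arr st queue (Posz a) = Posz (nth 0 Q a);
  bfs_le_lab : j <= m }.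

(** A node enters the queue at most once, so at most [n] nodes are explored, each with [m]
    queries. *)
Lemma run_bfs n m s k target query f c st :
  s < n ->
  (forall v w, v < n -> w < m -> query (Posz v) (Posz w) = Posz (f v w)) ->
  (forall v w, v < n -> w < m -> f v w < n) ->
  reg st numA = Posz m -> reg st bound = k -> reg st tgt = Posz target ->
  reg st src = Posz s ->
  (forall i, arr st dist i = 0%R) ->
  run query c bfs_prog st (fun t st' => exists d Q j,
    [/\ bfs_inv n m s f d Q (size Q) j, bfs_state m k target d Q (size Q) j st'
      & t <= n * (m * (c + 40) + 20) + 20]).
Proof.
move=> ltsn qE fn r0 r2 r9 r8 a1.
apply/run_seq/run_set_arr/run_seq/run_set_arr.
apply/run_seq/run_set_reg/run_seq/run_set_reg/run_seq/run_set_reg.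
(* Each node not yet left behind is allotted [c + 40] per label and 20 for advancing the head; the
   first [j] labels of the head are already paid for. *)
pose I b st := exists d Q h j,
  [/\ bfs_inv n m s f d Q h j, bfs_state m k target d Q h j st
    & b + j * (c + 40) = (n - h) * (m * (c + 40) + 20)].
apply: run_mono; first apply: (run_while (I := I) (b := n * (m * (c + 40) + 20))).
- move=> b st1 [d [Q [h [j [B S eb]]]]] /=.
  rewrite (bfs_headr S) (bfs_tail S) => lth.
  have {}lth : h < size Q by lia.
  have szQ := bfs_inv_size B.
  (* [h < size Q <= n], so the share of the current head can be split off the budget. *)
  have nexth : n - h = (n - h.+1).+1 by lia.
  rewrite nexth mulSn in eb.
  have xn : nth 0 Q h < n by apply: (bfs_bound B); rewrite mem_nth.
  have B' := @bfs_inv_next _ _ _ _ _ _ _ _ B lth.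
  have Bold := @bfs_inv_seen _ _ _ _ _ _ _ _ B lth.
  have Bnew := @bfs_inv_new _ _ _ _ _ _ _ _ B lth.
  case: S => S0 S2 S9 S10 S11 S12 Sd Sq lejm.
  apply: run_if => /=; rewrite S12 S0 => ltj; last first.
    have ej : j = m by lia.
    apply/run_seq/run_set_reg/run_set_reg.
    exists ((n - h.+1) * (m * (c + 40) + 20)); last by rewrite /=; lia.
    exists d, Q, h.+1, 0; split; last lia.
      by apply: B'; lia.
    by split; rewrite /= /upd //= S10; lia.
  have {}ltj : j < m by lia.
  set r := f (nth 0 Q h) j in Bold Bnew.
  have qr : query (Posz (nth 0 Q h)) (Posz j) = Posz r by rewrite qE.
  have leb : c + 40 <= b.
    by move: eb; set W := _ * (_ + 20); move: ltj; nia.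
  have eb' : b - (c + 40) + j.+1 * (c + 40) = (n - h) * (m * (c + 40) + 20).
    by rewrite nexth mulSn; nia.
  apply/run_seq/run_query; rewrite /= S10 S12 Sq // qr.
  apply: run_seq; apply: run_if; rewrite /= /upd /= Sd => dr.
    have {}dr : d r = 0 by lia.
    apply/run_seq/run_set_arr/run_seq/run_set_arr/run_set_reg/run_set_reg.
    exists (b - (c + 40)); last by rewrite /=; lia.
    exists (upd d r (d (nth 0 Q h)).+1), (rcons Q r), h, j.+1; split=> //.
      by apply: Bnew => //; apply: fn.
    split; rewrite /= /upd //= ?S10 ?S11 ?S12 ?size_rcons.
    + lia.
    + lia.
    + move=> v; rewrite eqz_nat; case: eqP => _; last exact: Sd.
      by rewrite Sq // Sd; lia.
    + move=> a lta; rewrite eqz_nat nth_rcons.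
      by case: (ltngtP a (size Q)) lta => [lt1 _|gt1 le1|-> //]; [rewrite Sq | lia].
  apply/run_skip/run_set_reg.
  exists (b - (c + 40)); last by rewrite /=; lia.
  exists d, Q, h, j.+1; split=> //.
    by apply: Bold; lia.
  by split; rewrite /= /upd //= S12; lia.
- exists (upd (fun=> 0) s 1), [:: s], 0, 0; split; last by rewrite subn0; lia.
    exact: bfs_inv_init.
  split; rewrite /= /upd //= r8.
    by move=> v; rewrite eqz_nat a1; case: eqP.
  by case.
- move=> t st1 [[b [d [Q [h [j [B S _]]]]]] /= g le_t].
  have eh : h = size Q.
    by move: g (bfs_head B); rewrite (bfs_headr S) (bfs_tail S); lia.
  by subst h; exists d, Q, j; split=> //; lia.
Qed.

(** * Paths between closed sets and generating sets *)

Definition step (query : int -> int -> int) (i j : nat) : nat :=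
  `|query (Posz i) (Posz j)|%N.

Section Generators.

Variables (A : finType) (cl : {set A} -> {set A}).
Variables (es : seq A) (cs : seq {set A}) (query : int -> int -> int).
Hypothesis mem_cs : forall Y, (Y \in cs) = (Y \in closed_sets cl).
Hypothesis cl_closure : closure_op cl.
Hypothesis uniq_es : uniq es.
Hypothesis mem_es : forall u, u \in es.
Hypothesis uniq_cs : uniq cs.
Hypothesis query_det : determines cl es cs query.

Lemma mem_cl X : cl X \in cs.
Proof. by rewrite mem_cs; apply: imset_f. Qed.

Lemma cl_setT : cl [set: A] = [set: A].
Proof.
by case: cl_closure => ext _ _; apply/eqP; rewrite eqEsubset subsetT ext.
Qed.

Lemma step_position v w : v < size cs -> w < size es ->
  query (Posz v) (Posz w) = Posz (step query v w) /\ step query v w < size cs.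
Proof.
move=> ltv ltw; have w0 : A by case: (es) ltw.
have /imsetP[X _ nthX] : nth set0 cs v \in closed_sets cl by rewrite -mem_cs mem_nth.
have := query_det X (nth w0 es w).
rewrite /step -nthX !index_uniq // => -> /=.
by rewrite index_mem mem_cl.
Qed.

(** [determines] allows any [X], not only closed ones, so each further label adds one element under
    the closure. *)
Lemma foldl_step us :
  foldl (step query) (index (cl set0) cs) [seq index u es | u <- us] =
  index (cl [set u in us]) cs.
Proof.
elim/last_ind: us => [|us u IH] /=.
  by congr (index (cl _) _); apply/setP=> x; rewrite !inE.
rewrite map_rcons foldl_rcons IH /step query_det /=.
by congr (index (cl _) _); apply/setP=> x; rewrite !inE mem_rcons inE.
Qed.

Lemma positions_of_elements ws : all (ltn^~ (size es)) ws ->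
  exists us, ws = [seq index u es | u <- us].
Proof.
elim: ws => [_|w ws IH /= /andP[ltw /IH[us ->]]]; first by exists [::].
have w0 : A by case: (es) ltw.
by exists (nth w0 es w :: us); rewrite /= index_uniq.
Qed.

(** Enumerating a generating set spells a path to A of that length; conversely, the labels of a
    shortest path form a generating set. The [k + 1] matches the shift in [d]. *)
Lemma bfs_mgs d Q j (k : int) :
  bfs_inv (size cs) (size es) (index (cl set0) cs) (step query) d Q (size Q) j ->
  (Posz (d (index [set: A] cs)) <= k + 1)%R = mgs cl k.
Proof.
move=> B.
have dist_le us : cl [set u in us] = [set: A] ->
    0 < d (index [set: A] cs) <= (size us).+1.
  move=> clu; have := bfs_inv_final (ws := [seq index u es | u <- us]) B.
  rewrite foldl_step clu size_map; apply.
  by apply/allP=> _ /mapP[u _ ->] /=; rewrite index_mem.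
apply/idP/existsP => [le_d|[X /andP[le_X /eqP clX]]]; last first.
  have := dist_le (enum X); rewrite set_enum clX -cardE => /(_ erefl); lia.
(* A generates itself, so it is reached; this excludes the value 0, which would pass the test for
   [k = -1]. *)
have dpos : 0 < d (index [set: A] cs).
  suff /dist_le/andP[]: cl [set u in enum [set: A]] = [set: A] by [].
  by rewrite set_enum cl_setT.
have [ws [lews szws foldws]] := bfs_path B dpos.
have [us def_ws] := positions_of_elements lews.
(* Labels may repeat along a path, so the set has at most [size us] elements. *)
exists [set u in us]; apply/andP; split.
  have: #|[set u in us]| <= size us by rewrite cardsE card_size.
  by move: szws; rewrite def_ws size_map; lia.
apply/eqP; move: foldws; rewrite def_ws foldl_step => /(congr1 (nth set0 cs)).
by rewrite !nth_index ?mem_cl // -cl_setT mem_cl.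
Qed.

End Generators.

(* The answer, 1 for yes and 0 for no, is left in register 0.  The [maxn 1]
   only matters when A is empty, where the product is 0. *)
Theorem corollary2p4 :
  exists (p : cmd) (K : nat),
    forall (A : finType) (cl : {set A} -> {set A}) (es : seq A)
           (cs : seq {set A}) (query : int -> int -> int) (c : nat) (k : int),
      closure_op cl ->
      perm_eq es (enum A) ->
      perm_eq cs (enum (closed_sets cl)) ->
      determines cl es cs query ->
      0 < c ->
      exists (t : nat) (st : state),
        [/\ exec query c p (mgs_input es cs k) t st,
            reg st 0 = ((mgs cl k : nat)%:Z)%R
          & t <= K * maxn 1 (c * #|A| * #|closed_sets cl|)].
Proof.
exists mgs_prog, 200 => A cl es cs query c k clo pes pcs det c0.
have mem_es u : u \in es by rewrite (perm_mem pes) mem_enum.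
have uniq_es : uniq es by rewrite (perm_uniq pes) enum_uniq.
have mem_cs Y : (Y \in cs) = (Y \in closed_sets cl).
  by rewrite (perm_mem pcs) mem_enum.
have uniq_cs : uniq cs by rewrite (perm_uniq pcs) enum_uniq.
have Y0c := mem_cl mem_cs set0.
have YTc : [set: A] \in cs by rewrite -(cl_setT clo) mem_cl.
have Y0min Y : Y \in cs -> cl set0 \subset Y.
  by case: clo => _ mono _; rewrite mem_cs => /imsetP[X _ ->]; rewrite mono ?sub0set.
have step_pos := step_position mem_cs uniq_es uniq_cs det.
(* The coefficients add up the scan, 30 and 40, and the search, [c + 40] and 20; the last 60 covers
   initialisations, loop exits and the final test. *)
suff [t [st [E [r0 le_t]]]] : run query c mgs_prog (mgs_input es cs k)
    (fun t st => reg st 0 = Posz (mgs cl k : nat) /\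
       t <= size cs * (size es * (c + 70) + 60) + 60).
  exists t, st; split=> //; apply: leq_trans le_t _.
  have sizeA : #|A| = size es by rewrite (perm_size pes) cardE.
  have sizeC : #|closed_sets cl| = size cs by rewrite (perm_size pcs) cardE.
  rewrite sizeA sizeC; set M := maxn 1 _.
  (* If A is empty there is at most one closed set, and [M] is at least 1; otherwise [size cs] is a
     factor of a product with positive cofactors. *)
  have n_le : size cs <= M.
    have [m0|m_gt0] := posnP (size es); last first.
      by apply: leq_trans (leq_maxr _ _); rewrite leq_pmull // muln_gt0 c0.
    apply: leq_trans (leq_maxl _ _).
    have -> : 1 = #|powerset [set: A]| by rewrite card_powerset cardsT sizeA m0.
    by rewrite -sizeC subset_leq_card //; apply/subsetP=> Y; rewrite powersetE subsetT.
  have nm_le : size cs * size es <= M.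
    by apply: leq_trans (leq_maxr _ _); rewrite -mulnA [size es * _]mulnC leq_pmull.
  have cnm_le : c * size es * size cs <= M := leq_maxr _ _.
  have M_ge1 : 1 <= M := leq_maxl _ _.
  (* The four terms contribute 1 + 70 + 60 + 60 = 191 times [M], within the constant 200. *)
  by move: M n_le nm_le cnm_le M_ge1 => M; lia.
apply: run_seq; apply: run_mono.
  exact: (run_scan k query c pes uniq_cs Y0c YTc Y0min).
move=> t1 st1 [[j1 S] le_t1]; apply: run_seq; apply: run_mono.
  apply: (@run_bfs (size cs) (size es) (index (cl set0) cs) k
    (index [set: A] cs) query (step query) c).
  - by rewrite index_mem.
  - by move=> v w ltv ltw; case: (step_pos v w ltv ltw).
  - by move=> v w ltv ltw; case: (step_pos v w ltv ltw).
  - exact: scan_numA S.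
  - exact: scan_bound S.
  - by apply: (scan_tgt S); rewrite index_mem.
  - by have [b [_ _ _]] := scan_best S; apply; rewrite index_mem.
  - by move=> i; rewrite (scan_arr S).
move=> t2 st2 [d [Q [j [B S' le_t2]]]].
have ans := bfs_mgs mem_cs clo uniq_es mem_es uniq_cs det k B.
apply: run_if; rewrite /= (bfs_tgt S') (bfs_dist S') (bfs_limit S') ans => yes;
  apply: run_set_reg; rewrite /= /upd /=; split; lia.
Qed.
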